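(* Let $X$ be a nonempty set, $\Theta$ be a nonempty open interval of $\mathbb{R}$, $f:\Theta\to\mathbb{R}$ be a strictly increasing function, and $p:X\to(0,\infty)$ and $\varphi:X\to\operatorname{conv}(f(\Theta))$ be functions. Define $\psi:X\times\Theta\to\mathbb{R}$ by $$\psi(x,t):=p(x)(\varphi(x)-f(t)),\qquad x\in X,\ t\in\Theta.$$ Then $\psi\in\Psi[T_n^{\boldsymbol{\lambda}}](X,\Theta)$ for each $n\in\mathbb{N}$ and $\boldsymbol{\lambda}=(\lambda_1,\dots,\lambda_n)\in\Lambda_n$, and $$\vartheta_{n,\psi}^{\boldsymbol{\lambda}}(\boldsymbol{x})=f^{(-1)}\bigg(\frac{\lambda_1p(x_1)\varphi(x_1)+\dots+\lambda_np(x_n)\varphi(x_n)}{\lambda_1p(x_1)+\dots+\lambda_np(x_n)}\bigg)$$ for all $\boldsymbol{x}=(x_1,\dots,x_n)\in X^n$. In particular, the equality $\vartheta_{1,\psi}=f^{(-1)}\circ\varphi$ holds.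
   Context: $\mathbb{N}$ is the set of positive integers; $\Lambda_n:=[0,\infty)^n\setminus\{(0,\ldots,0)\}$. $\operatorname{conv}(S)$ denotes the convex hull of $S\subseteq\mathbb{R}$ (the smallest interval containing $S$). Generalized left inverse: for a strictly increasing (not necessarily continuous) $f:\Theta\to\mathbb{R}$ on a nonempty open interval $\Theta$, $f^{(-1)}:\operatorname{conv}(f(\Theta))\to\Theta$ denotes the uniquely determined monotone function with $f^{(-1)}(f(u))=u$ for all $u\in\Theta$; it is increasing and continuous, and $f^{(-1)}(y)=\sup\{u\in\Theta:f(u)\leq y\}=\inf\{u\in\Theta:f(u)\geq y\}$ for $y\in\operatorname{conv}(f(\Theta))$. Point of sign change: for $g:\Theta\to\mathbb{R}$, an element $\vartheta\in\Theta$ is a point of sign change (of decreasing type) for $g$ if $g(t)>0$ for all $t\in\Theta$ with $t<\vartheta$ and $g(t)<0$ for all $t\in\Theta$ with $t>\vartheta$. $\Psi(X,\Theta)$ is the class of functions $\psi:X\times\Theta\to\mathbb{R}$ such that for each $x\in X$ there exist $t_+,t_-\in\Theta$ with $t_+<t_-$ and $\psi(x,t_+)>0>\psi(x,t_-)$. For $\boldsymbol{\lambda}\in\Lambda_n$, $\psi\in\Psi[T_n^{\boldsymbol{\lambda}}](X,\Theta)$ means that $\psi\in\Psi(X,\Theta)$ and for every $\boldsymbol{x}=(x_1,\ldots,x_n)\in X^n$ the function $\Theta\ni t\mapsto\sum_{i=1}^n\lambda_i\psi(x_i,t)$ has a (necessarily unique) point of sign change, denoted $\vartheta_{n,\psi}^{\boldsymbol{\lambda}}(\boldsymbol{x})$;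 for $\boldsymbol{\lambda}=(1,\ldots,1)$ it is denoted $\vartheta_{n,\psi}(\boldsymbol{x})$. *)

(* Defs.v *)
From mathcomp Require Import all_boot all_order all_algebra.
From mathcomp Require Import all_classical all_reals all_analysis.

Set Implicit Arguments.
Unset Strict Implicit.
Unset Printing Implicit Defensive.

Import Order.TTheory GRing.Theory Num.Theory.
Import numFieldNormedType.Exports.

Local Open Scope classical_set_scope.
Local Open Scope ring_scope.

(** Functions on a subset [Theta] of [R] (resp. on [X * Theta]) are represented
    by total functions on [R] (resp. [X -> R -> R]); every notion below depends
    only on their values at points of [Theta]. *)

Definition conv_hull (R : realType) (S : set R) : set R :=
  smallest (@is_interval R) S.

Definition monotone_on (R : realType) (A : set R) (g : R -> R) : Prop :=
  {in A &, {homo g : x y / x <= y}} \/ {in A &, {homo g : x y /~ x <= y}}.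

Definition is_gen_left_inverse (R : realType) (Theta : set R) (f g : R -> R) : Prop :=
  [/\ set_fun (conv_hull (f @` Theta)) Theta g,
      monotone_on (conv_hull (f @` Theta)) g
    & forall u, Theta u -> g (f u) = u].

(** For [Theta] a nonempty open interval and [f] strictly increasing on [Theta],
    the values of such a function are determined on [conv_hull (f @` Theta)];
    outside of this set they are arbitrary. *)
Definition gen_left_inverse (R : realType) (Theta : set R) (f : R -> R) : R -> R :=
  xget (fun=> 0) [set g | is_gen_left_inverse Theta f g].

Definition is_sign_change_point (R : realType) (Theta : set R) (g : R -> R)
    (theta : R) : Prop :=
  [/\ Theta theta,
      forall t, Theta t -> t < theta -> 0 < g t
    & forall t, Theta t -> theta < t -> g t < 0].

Definition Lambda (R : realType) (n : nat) : set 'rV[R]_n :=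
  [set l | forall i, 0 <= l 0 i] `\ 0.

Definition weighted_sum (R : realType) (X : Type) (psi : X -> R -> R) (n : nat)
    (l : 'rV[R]_n) (x : 'I_n -> X) (t : R) : R :=
  \sum_(i < n) l 0 i * psi (x i) t.

Definition Psi (R : realType) (X : Type) (Theta : set R) : set (X -> R -> R) :=
  [set psi | forall x, exists tp tm,
    [/\ Theta tp, Theta tm, tp < tm, 0 < psi x tp & psi x tm < 0]].

Definition PsiT (R : realType) (X : Type) (Theta : set R) (n : nat)
    (l : 'rV[R]_n) : set (X -> R -> R) :=
  [set psi | Psi Theta psi /\
    forall x : 'I_n -> X, exists theta,
      is_sign_change_point Theta (weighted_sum psi l x) theta].

(** A point of sign change on an interval is unique when it exists; [0] is the
    junk value when there is none. *)
Definition vartheta_w (R : realType) (X : Type) (Theta : set R)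
    (psi : X -> R -> R) (n : nat) (l : 'rV[R]_n) (x : 'I_n -> X) : R :=
  xget 0 [set theta | is_sign_change_point Theta (weighted_sum psi l x) theta].

Definition vartheta (R : realType) (X : Type) (Theta : set R)
    (psi : X -> R -> R) (n : nat) (x : 'I_n -> X) : R :=
  vartheta_w Theta psi (const_mx 1 : 'rV[R]_n) x.

(* Main.v *)
Require Import Defs.
From mathcomp Require Import all_boot all_order all_algebra.
From mathcomp Require Import all_classical all_reals all_analysis.

(** For a level [y] in the convex hull of [f(Theta)], the value of the
    generalized left inverse at [y] is exactly the point where the decreasing
    function [y - f] changes sign.  This turns the proposition into a statement
    about one kind of object, points of sign change, which are unique on an
    interval and do not depend on a positive factor of the function.

    On [Theta], the weighted sum of the [psi (x i)] is [W * (y - f)], where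
    [W > 0] is the sum of the weights [l 0 i * p (x i)] and [y] is the weighted
    average of the [phi (x i)].  An average lies between two of the averaged
    values, so [y] belongs to the convex hull, and the weighted sum changes sign
    at the value of the inverse at [y].

    The characterization of the inverse ([gen_left_inverse_sign_change]) has
    two sides.  A monotone left inverse of [f] must be nondecreasing, and then
    it sends [y] to the sign change of [y - f]
    ([sign_change_of_gen_left_inverse]).  Such an inverse exists, because a
    supremum provides a sign change of [y - f] for each [y] in the hull
    ([sign_change_exists]), and the map sending [y] to this point is monotone
    ([gen_left_inverse_exists]). *)

Set Implicit Arguments.
Unset Strict Implicit.
Unset Printing Implicit Defensive.

Import Order.TTheory GRing.Theory Num.Theory.
Import numFieldNormedType.Exports.

Local Open Scope classical_set_scope.
Local Open Scope ring_scope.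

(** * Convex hulls and weighted averages *)

Lemma conv_hull_itv (R : realType) (S : set R) : is_interval (conv_hull S).
Proof.
move=> a b Sa Sb z zab B [Bitv SB].
by apply: (Bitv a b) => //; [exact: Sa | exact: Sb].
Qed.

Lemma conv_hull_between (R : realType) (Theta : set R) (f : R -> R) (y : R) :
  conv_hull (f @` Theta) y ->
  exists a b, [/\ Theta a, Theta b, f a <= y & y <= f b].
Proof.
(* The levels lying between two values of f form an interval containing f(Theta). *)
apply: (@smallest_sub _ _ _
  [set y | exists a b, [/\ Theta a, Theta b, f a <= y & y <= f b]]).
- move=> u v [a [_ [Ta _ fa _]]] [_ [b [_ Tb _ fb]]] z /andP[uz zv].
  by exists a, b; split=> //; [exact: le_trans uz | exact: le_trans fb].
- by move=> _ [u Tu <-]; exists u, u; split.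
Qed.

(** If all values exceeded their average, every term of the null sum of the
    [w i * (v i - average)] would be nonnegative, hence null, and all the
    weights would vanish. *)
Lemma le_weighted_avg (R : realFieldType) (n : nat) (w v : 'I_n -> R) :
  (forall i, 0 <= w i) -> 0 < \sum_i w i ->
  exists i, v i <= (\sum_i w i * v i) / (\sum_i w i).
Proof.
move=> w_ge0 W_gt0; set y := _ / _; apply/existsP; apply: contraT.
rewrite negb_exists => /forallP v_gt.
have vy i : 0 < v i - y by rewrite subr_gt0 ltNge.
have sum0 : \sum_i w i * (v i - y) = 0.
  under eq_bigr do rewrite mulrBr.
  by rewrite sumrB -mulr_suml /y mulrC divfK ?subrr// gt_eqF.
have w0 i : w i = 0.
  have := psumr_eq0P (fun i _ => mulr_ge0 (w_ge0 i) (ltW (vy i))) sum0.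
  by move=> /(_ i isT)/eqP; rewrite mulf_eq0 (gt_eqF (vy i)) orbF => /eqP.
by rewrite big1 ?ltxx in W_gt0.
Qed.

Lemma weighted_avg_itv (R : realType) (C : set R) (n : nat) (w v : 'I_n -> R) :
  is_interval C -> (forall i, C (v i)) ->
  (forall i, 0 <= w i) -> 0 < \sum_i w i ->
  C ((\sum_i w i * v i) / (\sum_i w i)).
Proof.
move=> Citv Cv w_ge0 W_gt0.
have [i vi] := le_weighted_avg v w_ge0 W_gt0.
have [j] := le_weighted_avg (fun k => - v k) w_ge0 W_gt0.
under eq_bigr do rewrite mulrN.
rewrite sumrN mulNr lerN2 => vj.
by apply: (Citv (v i) (v j)) => //; apply/andP.
Qed.

(** * Points of sign change *)

(** Functions of the parameter are prescribed only on [Theta], so sign changes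
    have to be compared through equalities that hold there. *)
Lemma sign_change_scale (R : realType) (Theta : set R) (g h : R -> R) (c : R) :
  0 < c -> (forall t, Theta t -> g t = c * h t) ->
  is_sign_change_point Theta g = is_sign_change_point Theta h.
Proof.
move=> c_gt0 gE; apply/funext => theta; apply/propext.
split=> -[Tth pos neg]; split=> // t Tt tth.
- by have := pos t Tt tth; rewrite gE// pmulr_rgt0.
- by have := neg t Tt tth; rewrite gE// pmulr_rlt0.
- by rewrite gE// pmulr_rgt0//; exact: pos.
- by rewrite gE// pmulr_rlt0//; exact: neg.
Qed.

(** Raising a function moves its sign change to the right: between two points
    in the wrong order, the midpoint would give both signs.  The case [g = h]
    is uniqueness. *)
Lemma sign_change_le (R : realType) (Theta : set R) (g h : R -> R) (a b : R) :
  is_interval Theta -> (forall t, Theta t -> g t <= h t) ->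
  is_sign_change_point Theta g a -> is_sign_change_point Theta h b -> a <= b.
Proof.
move=> Titv gh [Ta gpos _] [Tb _ hneg]; rewrite leNgt; apply/negP => ba.
have [bm ma] := midf_lt ba; set m := _ / _ in bm ma.
have Tm : Theta m by apply: (Titv b a) => //; rewrite (ltW bm) (ltW ma).
have := lt_le_trans (gpos m Tm ma) (gh m Tm).
by rewrite ltNge (ltW (hneg m Tm bm)).
Qed.

Lemma sign_change_uniq (R : realType) (Theta : set R) (g : R -> R) (a b : R) :
  is_interval Theta ->
  is_sign_change_point Theta g a -> is_sign_change_point Theta g b -> a = b.
Proof.
move=> Titv ga gb; apply/eqP.
by rewrite eq_le (sign_change_le Titv _ ga gb)// (sign_change_le Titv _ gb ga).
Qed.

Lemma open_lt_gt (R : realType) (Theta : set R) (u : R) :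
  open Theta -> Theta u -> exists s t, [/\ Theta s, Theta t, s < u & u < t].
Proof.
move=> Topen Tu.
have /nbhs_ballP[e /= e_gt0 eT] := open_nbhs_nbhs (conj Topen Tu).
have e2 : 0 < e / 2 by rewrite divr_gt0.
have e2e : e / 2 < e by rewrite ltr_pdivrMr// ltr_pMr// ltr1n.
exists (u - e / 2), (u + e / 2); split.
- by apply: eT; rewrite /ball/= opprB addrC subrK gtr0_norm.
- by apply: eT; rewrite /ball/= opprD addrA subrr sub0r normrN gtr0_norm.
- by rewrite ltrBlDr ltrDl.
- by rewrite ltrDl.
Qed.

(** * The generalized left inverse *)

Section GenLeftInverse.
Context (R : realType) (Theta : set R) (f : R -> R).
Hypothesis Theta_neq0 : Theta !=set0.
Hypothesis Theta_open : open Theta.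
Hypothesis Theta_itv : is_interval Theta.
Hypothesis f_incr : {in Theta &, {homo f : u v / u < v}}.

Let f_lt u v : Theta u -> Theta v -> u < v -> f u < f v.
Proof. by move=> Tu Tv; apply: f_incr; rewrite inE. Qed.

Lemma sign_change_self u :
  Theta u -> is_sign_change_point Theta (fun t => f u - f t) u.
Proof.
by move=> Tu; split=> // t Tt tu; rewrite ?subr_gt0 ?subr_lt0 f_lt.
Qed.

(** The sign change is [sup [set u | Theta u /\ f u <= y]]; it stays in [Theta]
    because [y] is bracketed by two values of [f]. *)
Lemma sign_change_exists y : conv_hull (f @` Theta) y ->
  exists theta, is_sign_change_point Theta (fun t => y - f t) theta.
Proof.
move=> /conv_hull_between[a [b [Ta Tb fay yfb]]].
pose S := [set u | Theta u /\ f u <= y].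
have Sb : ubound S b.
  move=> u [Tu fuy]; rewrite leNgt; apply/negP => bu.
  by have := lt_le_trans (f_lt Tb Tu bu) (le_trans fuy yfb); rewrite ltxx.
have S_sup : has_sup S by split; [exists a; split | exists b].
have aS : a <= sup S by apply: ub_le_sup; [exact: S_sup.2 | split].
have Sbb : sup S <= b by apply: ge_sup => //; exact: S_sup.1.
exists (sup S); split=> [|t Tt tS|t Tt St].
- by apply: (Theta_itv Ta Tb); rewrite aS.
- have [u [Tu fuy] tu] := sup_gt (S_sup.1) tS.
  by rewrite subr_gt0 (lt_le_trans (f_lt Tt Tu tu)).
- rewrite subr_lt0 ltNge; apply/negP => fty.
  by have := ub_le_sup S_sup.2 (conj Tt fty); rewrite leNgt St.
Qed.

Lemma sign_change_of_gen_left_inverse g y :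
  is_gen_left_inverse Theta f g -> conv_hull (f @` Theta) y ->
  is_sign_change_point Theta (fun t => y - f t) (g y).
Proof.
move=> [gT gmon gf] Cy.
have Cf u : Theta u -> conv_hull (f @` Theta) (f u).
  by move=> Tu; apply: sub_gen_smallest; exists u.
case: gmon => g_mono; last first.
  (* A nonincreasing g would invert the order of two points of Theta. *)
  have [u0 Tu0] := Theta_neq0.
  have [s [_ [Ts _ su _]]] := open_lt_gt Theta_open Tu0.
  have := g_mono (f u0) (f s) (mem_set (Cf _ Tu0)) (mem_set (Cf _ Ts))
    (ltW (f_lt Ts Tu0 su)).
  by rewrite !gf// leNgt su.
split=> [|t Tt tg|t Tt tg]; first exact: gT.
- rewrite subr_gt0 ltNge; apply/negP => yft.
  have := g_mono _ _ (mem_set Cy) (mem_set (Cf _ Tt)) yft.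
  by rewrite gf// leNgt tg.
- rewrite subr_lt0 ltNge; apply/negP => fty.
  have := g_mono _ _ (mem_set (Cf _ Tt)) (mem_set Cy) fty.
  by rewrite gf// leNgt tg.
Qed.

Lemma gen_left_inverse_exists : exists g, is_gen_left_inverse Theta f g.
Proof.
pose g y := xget 0 (is_sign_change_point Theta (fun t => y - f t)).
have gP y : conv_hull (f @` Theta) y ->
    is_sign_change_point Theta (fun t => y - f t) (g y).
  by move=> /sign_change_exists; exact: xgetPex.
exists g; split.
- by move=> y /gP[].
- left=> y z /set_mem Cy /set_mem Cz yz.
  by apply: sign_change_le (gP y Cy) (gP z Cz) => // t _; rewrite lerD2r.
- move=> u Tu; apply: sign_change_uniq (sign_change_self Tu) => //.
  by apply: gP; apply: sub_gen_smallest; exists u.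
Qed.

Lemma gen_left_inverse_sign_change y : conv_hull (f @` Theta) y ->
  is_sign_change_point Theta (fun t => y - f t) (gen_left_inverse Theta f y).
Proof.
apply: sign_change_of_gen_left_inverse.
exact: (xgetPex _ gen_left_inverse_exists).
Qed.

End GenLeftInverse.

(** * Weighted sums *)

Lemma Lambda_sum_gt0 (R : realType) (n : nat) (l : 'rV[R]_n) (q : 'I_n -> R) :
  Lambda l -> (forall i, 0 < q i) -> 0 < \sum_i l 0 i * q i.
Proof.
move=> [l_ge0 l_neq0] q_gt0.
have t_ge0 i : 0 <= l 0 i * q i by rewrite mulr_ge0// ltW.
rewrite lt0r sumr_ge0// andbT; apply/negP => /eqP sum0; apply: l_neq0 => /=.
(* Being nonzero is stated for the family of entries of l. *)
apply/funext => k; apply/funext => i; rewrite (ord1 k).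
have /(_ i isT)/eqP := psumr_eq0P (fun i _ => t_ge0 i) sum0.
by rewrite mulf_eq0 (gt_eqF (q_gt0 i)) orbF => /eqP.
Qed.

Lemma weighted_sumE (R : realType) (X : Type) (Theta : set R)
    (f : R -> R) (p phi : X -> R) (psi : X -> R -> R)
    (psiE : forall x t, Theta t -> psi x t = p x * (phi x - f t))
    (n : nat) (l : 'rV[R]_n) (x : 'I_n -> X) (t : R) :
  \sum_i l 0 i * p (x i) != 0 -> Theta t ->
  weighted_sum psi l x t =
  (\sum_i l 0 i * p (x i)) *
  ((\sum_i l 0 i * p (x i) * phi (x i)) / (\sum_i l 0 i * p (x i)) - f t).
Proof.
move=> W_neq0 Tt; rewrite mulrBr mulrCA divff// mulr1 mulr_suml -sumrB.
by apply: eq_bigr => i _; rewrite psiE// mulrA mulrBr.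
Qed.

Theorem proposition2p22 (R : realType) (X : Type) (Theta : set R)
    (f : R -> R) (p phi : X -> R) (psi : X -> R -> R)
    (X_neq0 : [set: X] !=set0)
    (Theta_neq0 : Theta !=set0) (Theta_open : open Theta)
    (Theta_itv : is_interval Theta)
    (f_incr : {in Theta &, {homo f : u v / u < v}})
    (p_gt0 : forall x, 0 < p x)
    (phi_conv : forall x, conv_hull (f @` Theta) (phi x))
    (psiE : forall x t, Theta t -> psi x t = p x * (phi x - f t)) :
  (forall (n : nat) (l : 'rV[R]_n), (0 < n)%N -> Lambda l ->
     PsiT Theta l psi /\
     forall x : 'I_n -> X,
       vartheta_w Theta psi l x =
       gen_left_inverse Theta f
         ((\sum_(i < n) l 0 i * p (x i) * phi (x i)) /
          (\sum_(i < n) l 0 i * p (x i)))) /\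
  (fun x : X => vartheta Theta psi (fun _ : 'I_1 => x)) =
  gen_left_inverse Theta f \o phi.
Proof.
have gP := gen_left_inverse_sign_change Theta_neq0 Theta_open Theta_itv f_incr.
have PsiP : Psi Theta psi.
  move=> x; have [Tth pos neg] := gP _ (phi_conv x).
  have [s [t [Ts Tt sth tht]]] := open_lt_gt Theta_open Tth.
  exists s, t; split=> //; first exact: lt_trans tht.
  - by rewrite psiE// pmulr_rgt0// pos.
  - by rewrite psiE// pmulr_rlt0// neg.
have main n (l : 'rV[R]_n) : Lambda l -> forall x : 'I_n -> X,
    is_sign_change_point Theta (weighted_sum psi l x)
      (gen_left_inverse Theta f
         ((\sum_(i < n) l 0 i * p (x i) * phi (x i)) /
          (\sum_(i < n) l 0 i * p (x i)))).
  move=> Ll x; have W_gt0 := Lambda_sum_gt0 Ll (fun i => p_gt0 (x i)).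
  rewrite (sign_change_scale W_gt0
    (fun t => weighted_sumE psiE (lt0r_neq0 W_gt0) (t := t))).
  apply: gP; apply: weighted_avg_itv => //; first exact: conv_hull_itv.
  by move=> i; rewrite mulr_ge0 ?(ltW (p_gt0 _))//; exact: Ll.1.
have varthetaE n (l : 'rV[R]_n) : Lambda l -> forall x : 'I_n -> X,
    vartheta_w Theta psi l x =
    gen_left_inverse Theta f
      ((\sum_(i < n) l 0 i * p (x i) * phi (x i)) /
       (\sum_(i < n) l 0 i * p (x i))).
  move=> Ll x; apply: (sign_change_uniq Theta_itv) (main n l Ll x).
  exact: (xgetPex 0 (ex_intro _ _ (main n l Ll x))).
split=> [n l _ Ll|].
  split; last exact: varthetaE.
  by split=> // x; eexists; exact: main.
apply/funext => x; rewrite /vartheta varthetaE /=; last first.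
  split=> [i|/= /(congr1 (fun u => u 0 0))/eqP]; first by rewrite mxE.
  by rewrite mxE oner_eq0.
by rewrite !big_ord1 !mxE !mul1r mulrC mulKf// gt_eqF.
Qed.
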